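(* Let $N\ge 2$ and $q\in(0,1]$ be fixed. For any constant $a_s \ge \frac{2\sqrt{2}\binom{N}{2}}{q}$, the static policy $\pi^s$ with parameter $a_s$ satisfies $\mathbb{E}[Gap^s(T)]\in\mathcal{O}(1)$ as $T\to\infty$.
   Context: Balls-into-bins model: $T$ balls are sequentially allocated into $N\ge 2$ initially empty bins. In each period $t\in\{1,\dots,T\}$ a ball arrives; it has a preferred bin $P(t)$ drawn uniformly at random from $\{1,\dots,N\}$, and it is flexible ($f(t)=1$) with probability $q\in(0,1]$, otherwise $f(t)=0$. All draws are independent across periods and of each other. A policy $\pi$ is a non-anticipating rule determining $\omega^\pi(t)\in\{0,1\}$ (whether to exert flexibility in period $t$) from the numbers of balls in the bins; it may depend on $T$. If $f(t)\omega^\pi(t)=1$, a flex set $\mathcal F(t)$ of two distinct bins is drawn uniformly at random and the ball is put in the bin of $\mathcal F(t)$ with the smaller current load (ties broken in favour of the smallest index). If $f(t)\omega^\pi(t)=0$ the ball is put in $P(t)$. Let $x_i^\pi(t)$ be the load (number of balls) of bin $i$ at the end of period $t$, $x_i^\pi(0)=0$, and $Gap^\pi(t)=\max_{i}x_i^\pi(t)-t/N$. Static policy $\pi^s$ (superscript $s$): given a constant $a_s>0$, let $\widehat T=\lfloor T-a_s\sqrt{T\log T}\rfloor$; the policy sets $\omega^s(t)=1$ for all $t\ge\widehat T$ and $\omega^s(t)=0$ for $t<\widehat T$. Asymptotic notation is with respect to $T$, with $N,q,a_s$ fixed. *)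

(* Defs.v *)
From HB Require Import structures.
From mathcomp Require Import all_boot all_order all_algebra.
From mathcomp Require Import all_classical all_reals all_analysis.

Set Implicit Arguments.
Unset Strict Implicit.
Unset Printing Implicit Defensive.

Import Order.TTheory GRing.Theory Num.Theory.
Import numFieldNormedType.Exports.

Local Open Scope classical_set_scope.
Local Open Scope ring_scope.

(* Mutual independence of a finite family of classes of events. *)
Definition mutually_independent d (Omega : measurableType d) (R : realType)
    (Pr : probability Omega R) (I : finType) (F : I -> set (set Omega)) : Prop :=
  (forall i, F i `<=` measurable) /\
  forall (J : {set I}) (E : I -> set Omega),
    (forall i, i \in J -> F i (E i)) ->
    Pr (\bigcap_(i in [set` J]) E i) = (\prod_(i in J) Pr (E i))%E.

(* The sigma-algebra generated by a draw X with values in a finite type, every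
   subset of which is taken to be measurable. *)
Definition events_of (Omega : Type) (A : finType) (X : Omega -> A) :
    set (set Omega) := [set X @^-1` B | B in [set: set A]].

Definition flex_pair (N : nat) := {S : {set 'I_N} | #|S| == 2%N}.

(* The random draws of the first T periods.  Periods are numbered from 1: the
   index i : 'I_T stands for period i.+1, and the values of the draws outside
   1..T are irrelevant.  A flex set is drawn in every period, but it is only
   looked at (see [place]) when flexibility is available and exerted. *)
Record draws (R : realType) (N : nat) (q : R) (T : nat) := Draws {
  disp : measure_display;
  Omega : measurableType disp;
  Pr : probability Omega R;
  preferred : nat -> Omega -> 'I_N;
  flexible : nat -> Omega -> bool;
  flex_set : nat -> Omega -> flex_pair N;
  preferred_unif : forall (i : 'I_T) (b : 'I_N),
    Pr (preferred i.+1 @^-1` [set b]) = (N%:R^-1)%:E;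
  flexible_bern : forall i : 'I_T,
    Pr (flexible i.+1 @^-1` [set true]) = q%:E;
  flex_set_unif : forall (i : 'I_T) (S : flex_pair N),
    Pr (flex_set i.+1 @^-1` [set S]) = ('C(N, 2)%:R^-1)%:E;
  draws_indep : mutually_independent Pr
    (fun k : 'I_T + 'I_T + 'I_T => match k with
       | inl (inl i) => events_of (preferred i.+1)
       | inl (inr i) => events_of (flexible i.+1)
       | inr i => events_of (flex_set i.+1)
     end)
}.

Definition loads (N : nat) := {ffun 'I_N -> nat}.

(* For a given horizon: period and loads at the end of the previous period
   |-> whether flexibility is exerted in that period. *)
Definition policy (N : nat) := nat -> loads N -> bool.

(* i is the least loaded bin of S, ties going to the smallest index. *)
Definition least_loaded (N : nat) (x : loads N) (S : {set 'I_N}) (i : 'I_N) :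
    bool :=
  (i \in S) &&
  [forall j in S, (x i < x j)%N || (x i == x j) && (i <= j)%N].

Definition place (N : nat) (x : loads N) (flex : bool) (p : 'I_N)
    (S : flex_pair N) : loads N :=
  [ffun i => (x i + (if flex then least_loaded x (val S) i else i == p))%N].

Fixpoint load (R : realType) (N : nat) (q : R) (T : nat) (D : draws N q T)
    (pi : policy N) (t : nat) (w : Omega D) : loads N :=
  if t is s.+1 then
    let x := load pi s w in
    place x (flexible t w && pi t x) (preferred t w) (flex_set t w)
  else [ffun=> 0%N].

Definition gap (R : realType) (N : nat) (q : R) (T : nat) (D : draws N q T)
    (pi : policy N) (t : nat) (w : Omega D) : R :=
  (\max_(i < N) load pi t w i)%:R - t%:R / N%:R.

(* The switching time is a (possibly negative) integer. *)
Definition switch_time (R : realType) (a : R) (T : nat) : int :=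
  Num.floor (T%:R - a * Num.sqrt (T%:R * ln T%:R)).

Definition static_policy (R : realType) (N : nat) (a : R) (T : nat) : policy N :=
  fun t _ => switch_time a T <= t%:Z.

(* The gap takes finitely many values, so its expectation is finite and [fine]
   loses nothing. *)
Definition expected_gap (R : realType) (N : nat) (q : R) (T : nat)
    (D : draws N q T) (pi : policy N) (t : nat) : R :=
  fine ('E_(Pr D)[gap (D := D) pi t])%E.

(* Main.v *)
Require Import Defs.
From HB Require Import structures.
From mathcomp Require Import all_boot all_order all_algebra.
From mathcomp Require Import all_classical all_reals all_analysis.
From mathcomp Require Import perm ring lra zify.
Import Order.TTheory GRing.Theory Num.Theory.
Import numFieldNormedType.Exports.
Local Open Scope classical_set_scope.
Local Open Scope ring_scope.

(* Since the loads sum to T, the gap lies between 0 and the sum over all pairs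
   of bins of |x_i - x_j|, so it suffices to bound E|d| for each difference
   d = x_i - x_j.  It moves by at most 1 per period, is a martingale in the
   random phase, and is pulled towards 0 in the flexible phase at rate at least
   delta = q / C(N, 2), because the flex set {i, j} always favours the emptier
   bin and the other flex sets never favour the fuller one on balance.
   With k periods left in the flexible phase, two functions of |d| dominate the
   expected final value of (delta / 3) |d|: one built on exp(delta |d| / 3),
   which is bounded near 0, and one of the form const + T exp(- c k) exp(l |d|)
   with l = sqrt(ln T / T), which accounts for not reaching 0 in time.  Their
   minimum is again a supersolution of the backward equation, since at 0 the
   first is the smaller one.  In the second, the fluctuations of both phases cost
   at most a factor exp(l^2 T) = T, whereas the drift of the flexible phase, of
   length at least a sqrt(T ln T), gains a factor T^(- 2 sqrt 2). *)

Set Implicit Arguments.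
Unset Strict Implicit.
Unset Printing Implicit Defensive.

(** * Quadratic bound for the exponential *)

Lemma expR_le_quadratic (R : realType) (x : R) :
  x <= 3^-1 -> expR x <= 1 + x + x ^+ 2.
Proof.
move=> x_le.
(* Squaring this gives [(1 - x / 2)^2 * expR x <= 1] without a series expansion. *)
have h : 1 - x / 2 <= expR (- (x / 2)) by have := expR_ge1Dx (- (x / 2)).
have h0 : 0 < 1 - x / 2 by lra.
have h2 : (1 - x / 2) ^+ 2 * expR x <= 1.
  have e1 : expR (- (x / 2)) ^+ 2 * expR x = 1.
    by rewrite -expRM_natl -expRD -[RHS]expR0; congr expR; field.
  by rewrite -[leRHS]e1 ler_pM2r ?expR_gt0// ler_sqr ?nnegrE ?expR_ge0// ltW.
have h3 : 1 <= (1 - x / 2) ^+ 2 * (1 + x + x ^+ 2).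
  rewrite [leRHS](_ : _ = 1 + x ^+ 2 * (1 - 3 * x + x ^+ 2) / 4); last by field.
  (* The threshold [x <= 1/3] makes [1 - 3 * x] nonnegative. *)
  suff : 0 <= x ^+ 2 * (1 - 3 * x + x ^+ 2) by lra.
  by apply: mulr_ge0; [exact: sqr_ge0 | have := sqr_ge0 x; lra].
rewrite -(@ler_pM2l _ ((1 - x / 2) ^+ 2)) ?exprn_gt0//.
exact: le_trans h2 h3.
Qed.

(** * Placement of a ball and symmetry of flex sets *)

Section Placement.
Context (N : nat).
Implicit Types (x : loads N) (i j : 'I_N) (S : flex_pair N).

Lemma least_loaded_uniq x (A : {set 'I_N}) i j :
  least_loaded x A i -> least_loaded x A j -> i = j.
Proof.
move=> /andP[iA /forall_inP hi] /andP[jA /forall_inP hj].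
by apply: ord_inj; have := hi j jA; have := hj i iA; lia.
Qed.

Lemma least_loaded_exists x (A : {set 'I_N}) i0 :
  i0 \in A -> exists i, least_loaded x A i.
Proof.
move=> i0A.
(* Indices are below [N], so this key orders bins by load and then by index, as the tie rule
   does. *)
case: (@arg_minnP _ i0 [in A] (fun i => x i * N + i)%N i0A) => i iA imin.
exists i; rewrite /least_loaded [i \in A]iA; apply/forall_inP => j jA.
have := imin j jA; have := ltn_ord i; have := ltn_ord j; nia.
Qed.

Lemma sum_least_loaded x S : (\sum_i least_loaded x (val S) i = 1)%N.
Proof.
have /card_gt0P[i0 i0S] : (0 < #|val S|)%N by rewrite (eqP (valP S)).
have [i hi] := least_loaded_exists x i0S.
rewrite (bigD1 i)//= hi big1 ?addn0// => j jDi.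
by apply/eqP; rewrite eqb0; apply: contra jDi => hj;
  apply/eqP/(least_loaded_uniq hj hi).
Qed.

Lemma sum_place x b p S : (\sum_i place x b p S i = (\sum_i x i).+1)%N.
Proof.
under eq_bigr do rewrite ffunE.
rewrite big_split/= -[RHS]addn1; congr addn.
case: b; first exact: sum_least_loaded.
by rewrite (bigD1 p)//= eqxx big1// => i /negPf ->.
Qed.

Definition swap_pair i j S : flex_pair N :=
  exist _ (tperm i j @: val S)
    (etrans (congr1 (eq_op^~ 2%N) (card_imset _ perm_inj)) (valP S)).

Lemma swap_pairK i j : involutive (swap_pair i j).
Proof.
move=> S; apply: val_inj => /=; rewrite -imset_comp -[RHS]imset_id.
by apply: eq_imset => k /=; rewrite tpermK.
Qed.

(** [j] is strictly lighter than [i], hence than every bin of [S], so ties never interfere. *)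
Lemma least_loaded_swap x i j S : (x j < x i)%N ->
  least_loaded x (val S) i -> least_loaded x (val (swap_pair i j S)) j.
Proof.
move=> xji /andP[iS /forall_inP hi]; apply/andP; split.
  by rewrite -[j in j \in _](tpermL i j) imset_f.
apply/forall_inP => _ /imsetP[l lS ->].
by have := hi l lS; case: tpermP => [->|->|_ _]; lia.
Qed.

(* Swapping i and j injects the flex sets that send the ball to i into those
   that send it to j, and misses {i, j} itself. *)
Lemma sum_least_loaded_lt x i j : (x j < x i)%N ->
  (\sum_(S : flex_pair N) least_loaded x (val S) i <
   \sum_(S : flex_pair N) least_loaded x (val S) j)%N.
Proof.
move=> xji; have iDj : i != j by apply: contraTneq xji => ->; rewrite ltnn.
have c2 : #|[set i; j]%SET| == 2%N by rewrite cards2 iDj.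
pose S0 : flex_pair N := exist _ [set i; j]%SET c2.
have S0K : swap_pair i j S0 = S0.
  by apply: val_inj; rewrite /= imsetU1 imset_set1 tpermL tpermR finset.setUC.
rewrite [ltnRHS](reindex_inj (inv_inj (swap_pairK i j))).
rewrite [ltnRHS](bigD1 S0)// [ltnLHS](bigD1 S0)// S0K -addSn leq_add//.
  rewrite [val S0]/=.
  have -> : least_loaded x [set i; j]%SET i = false.
    by apply/negP => /andP[_ /forall_inP/(_ j)]; rewrite !inE eqxx orbT; lia.
  suff -> : least_loaded x [set i; j]%SET j by [].
  apply/andP; split; first by rewrite !inE eqxx orbT.
  by apply/forall_inP => k; rewrite !inE => /orP[]/eqP ->; lia.
apply: leq_sum => S _.
by case: (boolP (least_loaded x (val S) i)) => // /(least_loaded_swap xji) /= ->.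
Qed.

Lemma card_flex_pair : #|{: flex_pair N}| = 'C(N, 2).
Proof. by rewrite card_sig -[in RHS](card_ord N) -card_draws cardsE. Qed.

End Placement.

(** * Averages over the draws of one period *)

Definition draw (N : nat) : finType := ('I_N * bool * flex_pair N)%type.

Definition weight (R : realType) (N : nat) (q : R) (c : draw N) : R :=
  N%:R^-1 * (if c.1.2 then q else 1 - q) * 'C(N, 2)%:R^-1.

Definition avg (R : realType) (N : nat) (q : R) (g : draw N -> R) : R :=
  \sum_c weight q c * g c.

Definition next (N : nat) (b : bool) (x : loads N) (c : draw N) : loads N :=
  place x (c.1.2 && b) c.1.1 c.2.

Definition diff (R : realType) (N : nat) (i j : 'I_N) (x : loads N) : R :=
  (x i)%:R - (x j)%:R.

Section Step.
Context (R : realType) (N : nat) (q : R).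
Hypotheses (N2 : (2 <= N)%N) (q01 : 0 < q <= 1).
Implicit Types (x : loads N) (i j : 'I_N) (g h : draw N -> R).

Let N_gt0 : 0 < N%:R :> R. Proof. by rewrite ltr0n; lia. Qed.

Let C_gt0 : 0 < 'C(N, 2)%:R :> R. Proof. by rewrite ltr0n bin_gt0. Qed.

Lemma weight_ge0 (c : draw N) : 0 <= weight q c.
Proof.
rewrite /weight !mulr_ge0 ?invr_ge0 ?ler0n//.
by case/andP: q01 => q_gt0 q_le1; case: ifP => _; lra.
Qed.

Lemma avgE g : avg q g =
  \sum_p \sum_S ((1 - q) * g (p, false, S) + q * g (p, true, S)) /
                (N%:R * 'C(N, 2)%:R).
Proof.
transitivity (\sum_p \sum_b \sum_S weight q (p, b, S) * g (p, b, S)).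
  by rewrite pair_bigA pair_bigA; apply: eq_bigr => -[[]].
apply: eq_bigr => p _; rewrite big_bool/= -big_split/=; apply: eq_bigr => S _.
by rewrite /weight/=; field; rewrite !gt_eqF.
Qed.

Lemma avg_cst (k : R) : avg q (fun _ : draw N => k) = k.
Proof.
rewrite avgE sumr_const sumr_const -[LHS]mulr_natr -[X in X * _]mulr_natr.
rewrite card_flex_pair card_ord.
by field; rewrite !gt_eqF.
Qed.

Lemma avgD g h : avg q (fun c => g c + h c) = avg q g + avg q h.
Proof. by rewrite /avg -big_split; apply: eq_bigr => c _; rewrite mulrDr. Qed.

Lemma avgZ (k : R) g : avg q (fun c => k * g c) = k * avg q g.
Proof. by rewrite /avg mulr_sumr; apply: eq_bigr => c _; rewrite mulrCA. Qed.

Lemma avg_le g h : (forall c, g c <= h c) -> avg q g <= avg q h.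
Proof.
by move=> gh; apply: ler_sum => c _; rewrite ler_wpM2l ?weight_ge0.
Qed.

Lemma sum_ord_eq i : \sum_(p < N) ((i == p)%:R : R) = 1.
Proof.
by rewrite (bigD1 i)//= eqxx big1 ?addr0// => p; rewrite eq_sym => /negPf ->.
Qed.

(** Reduces the drift of a bin to counting the flex sets that send the ball to it. *)
Lemma avg_next b x i : avg q (fun c => (next b x c i)%:R) = (x i)%:R +
  if b then (1 - q) / N%:R +
         q / 'C(N, 2)%:R * (\sum_(S : flex_pair N) least_loaded x (val S) i)%:R
  else N%:R^-1.
Proof.
transitivity (avg q (fun c => (x i)%:R +
    (if c.1.2 && b then least_loaded x (val c.2) i else i == c.1.1)%:R)).
  by apply: eq_bigr => c _; rewrite /next ffunE natrD.
rewrite avgD avg_cst; congr (_ + _); rewrite avgE/=; case: b => /=.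
- set L := (\sum_S _)%N.
  transitivity (\sum_(p < N) ((1 - q) / N%:R * (i == p)%:R +
                              N%:R^-1 * (q / 'C(N, 2)%:R * L%:R))).
    apply: eq_bigr => p _; rewrite -mulr_suml big_split/= sumr_const.
    rewrite card_flex_pair -[X in X + _]mulr_natr -mulr_sumr -natr_sum.
    by field; rewrite !gt_eqF.
  rewrite big_split/= -mulr_sumr sum_ord_eq sumr_const card_ord.
  by rewrite -[X in _ + X]mulr_natr; field; rewrite !gt_eqF.
- transitivity (\sum_(p < N) N%:R^-1 * ((i == p)%:R : R)).
    apply: eq_bigr => p _; rewrite sumr_const card_flex_pair -[LHS]mulr_natr.
    by field; rewrite !gt_eqF.
  by rewrite -mulr_sumr sum_ord_eq mulr1.
Qed.

Lemma avg_diff_next b x i j : avg q (fun c => diff R i j (next b x c)) =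
  avg q (fun c => (next b x c i)%:R) - avg q (fun c => (next b x c j)%:R).
Proof.
by rewrite -mulN1r -avgZ -avgD; apply: eq_bigr => c _; rewrite mulN1r.
Qed.

Lemma avg_diff_random x i j :
  avg q (fun c => diff R i j (next false x c)) = diff R i j x.
Proof. by rewrite avg_diff_next !avg_next /diff; ring. Qed.

(** The inflexible contributions cancel, and two integer counts in strict order differ by at least
    1, whence the rate. *)
Lemma avg_diff_flexible x i j : (x j < x i)%N ->
  avg q (fun c => diff R i j (next true x c)) <= diff R i j x - q / 'C(N, 2)%:R.
Proof.
move=> /sum_least_loaded_lt; rewrite -addn1 -(ler_nat R) natrD => h.
rewrite avg_diff_next !avg_next /diff.
have : q / 'C(N, 2)%:R * 1 <= q / 'C(N, 2)%:R *
  ((\sum_(S : flex_pair N) least_loaded x (val S) j)%:R -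
   (\sum_(S : flex_pair N) least_loaded x (val S) i)%:R) :> R.
  rewrite ler_wpM2l ?divr_ge0 ?ler0n//; first by case/andP: q01 => /ltW.
  by rewrite lerBrDl.
by rewrite mulrBr mulr1; lra.
Qed.

Lemma diff_next_bound b x c i j : `|diff R i j (next b x c) - diff R i j x| <= 1.
Proof.
rewrite /diff /next !ffunE !natrD.
by rewrite ler_norml; case: (_ && b); [case: (least_loaded _ _ i);
  case: (least_loaded _ _ j) | case: (i == _); case: (j == _)];
  apply/andP; split; rewrite /=; lra.
Qed.

(** Increments are at most 1 in absolute value, so [l] times an increment is in the range of
    [expR_le_quadratic]; the linear term retains the mean drift. *)
Lemma avg_expR_diff b x i j (l : R) : `|l| <= 3^-1 ->
  avg q (fun c => expR (l * diff R i j (next b x c))) <=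
  expR (l * diff R i j x) *
    (1 + l * (avg q (fun c => diff R i j (next b x c)) - diff R i j x) + l ^+ 2).
Proof.
move=> l3; set d := diff R i j x.
apply: (@le_trans _ _ (avg q (fun c => expR (l * d) * ((1 - l * d + l ^+ 2) +
    l * diff R i j (next b x c))))).
  apply: avg_le => c; have := diff_next_bound b x c i j.
  rewrite -/d; set e := diff R i j (next b x c) => h.
  rewrite [in leLHS](_ : l * e = l * d + l * (e - d)); last by ring.
  rewrite expRD ler_wpM2l ?expR_ge0//.
  have le1 : `|l * (e - d)| <= `|l| by rewrite normrM ler_piMr.
  have := expR_le_quadratic (le_trans (ler_norm _) (le_trans le1 l3)).
  have : (l * (e - d)) ^+ 2 <= l ^+ 2.
    by rewrite -real_normK ?num_real// -[leRHS]real_normK ?num_real// ler_sqr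
      ?nnegrE.
  by rewrite mulrBr; lra.
by rewrite avgZ avgD avg_cst avgZ le_eqVlt; apply/orP; left; apply/eqP; ring.
Qed.

End Step.

(** * Finite histories and the backward equation *)

Section History.
Context (A : finType).

Definition ffun_belast (s : nat) (z : {ffun 'I_s.+1 -> A}) : {ffun 'I_s -> A} :=
  [ffun i => z (widen_ord (leqnSn s) i)].

Definition ffun_rcons (s : nat) (u : {ffun 'I_s -> A} * A) :
    {ffun 'I_s.+1 -> A} :=
  [ffun i => if unlift ord_max i is Some j then u.1 j else u.2].

Lemma widen_ord_max (s : nat) (i : 'I_s) :
  widen_ord (leqnSn s) i = lift ord_max i.
Proof. by apply: val_inj; rewrite [RHS]lift_max. Qed.

Lemma ffun_rcons_widen s (u : {ffun 'I_s -> A} * A) i :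
  ffun_rcons u (widen_ord (leqnSn s) i) = u.1 i.
Proof. by rewrite ffunE widen_ord_max liftK. Qed.

Lemma ffun_rcons_max s (u : {ffun 'I_s -> A} * A) :
  ffun_rcons u ord_max = u.2.
Proof. by rewrite ffunE unlift_none. Qed.

Lemma ffun_rconsK s :
  cancel (@ffun_rcons s) (fun z => (ffun_belast z, z ord_max)).
Proof.
move=> [z c]; rewrite ffun_rcons_max; congr pair.
by apply/ffunP => i; rewrite ffunE ffun_rcons_widen.
Qed.

Lemma ffun_belastK s :
  cancel (fun z => (ffun_belast z, z ord_max)) (@ffun_rcons s).
Proof.
move=> z; apply/ffunP => i; rewrite ffunE /=.
by case: unliftP => [j|] ->; rewrite // ffunE widen_ord_max.
Qed.

(** Lets the last draw be averaged with the past fixed: a finite form of conditioning. *)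
Lemma sum_ffun_recr (V : nmodType) s (F : {ffun 'I_s.+1 -> A} -> V) :
  \sum_z F z = \sum_z \sum_c F (ffun_rcons (z, c)).
Proof.
rewrite pair_bigA (reindex (@ffun_rcons s)) /=; last first.
  by apply: onW_bij; exists (fun z => (ffun_belast z, z ord_max));
    [exact: ffun_rconsK | exact: ffun_belastK].
by apply: eq_bigr => -[].
Qed.

End History.

(** The load process as a deterministic function of finitely many draws, so that expectations become
    finite sums. *)
Fixpoint run (N : nat) (pi : policy N) (t : nat) :
    {ffun 'I_t -> draw N} -> loads N :=
  if t is s.+1 then fun z =>
    let x := run pi (ffun_belast z) in next (pi t x) x (z ord_max)
  else fun _ => [ffun=> 0%N].

Lemma sum_run (N : nat) (pi : policy N) (t : nat) (z : {ffun 'I_t -> draw N}) :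
  (\sum_i run pi z i = t)%N.
Proof.
elim: t z => [|t IH] z /=; first by rewrite big1// => i _; rewrite ffunE.
by rewrite sum_place IH.
Qed.

Definition path_weight (R : realType) (N : nat) (q : R) (t : nat)
    (z : {ffun 'I_t -> draw N}) : R := \prod_i weight q (z i).

(* V is a supersolution of the backward equation, so V t (load t) is a
   supermartingale. *)
Lemma supersolution_bound (R : realType) (N : nat) (q : R) (pi : policy N)
    (T : nat) (V : nat -> loads N -> R) :
  (2 <= N)%N -> 0 < q <= 1 ->
  (forall t x, (t < T)%N ->
    avg q (fun c => V t.+1 (next (pi t.+1 x) x c)) <= V t x) ->
  \sum_(z : {ffun 'I_T -> draw N}) path_weight q z * V T (run pi z) <=
    V 0%N [ffun=> 0%N].
Proof.
move=> N2 q01 superV.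
suff : forall t, (t <= T)%N ->
    \sum_(z : {ffun 'I_t -> draw N}) path_weight q z * V t (run pi z) <=
    V 0%N [ffun=> 0%N] by apply.
elim=> [|t IH] tT.
  rewrite (eq_bigr (fun=> V 0%N [ffun=> 0%N])) => [|z _].
    by rewrite sumr_const card_ffun card_ord expn0.
  by rewrite /path_weight big_ord0 mul1r.
apply: le_trans (IH (ltnW tT)); rewrite sum_ffun_recr.
apply: ler_sum => z _.
apply: le_trans (_ : path_weight q z * avg q (fun c =>
    V t.+1 (next (pi t.+1 (run pi z)) (run pi z) c)) <= _).
  rewrite /avg mulr_sumr; apply: ler_sum => c _.
  have e : ffun_belast (ffun_rcons (z, c)) = z.
    by have [] := ffun_rconsK (z, c).
  rewrite /path_weight big_ord_recr /= e ffun_rcons_max mulrA.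
  by under eq_bigr do rewrite ffun_rcons_widen.
apply: ler_wpM2l; last exact: superV.
by apply: prodr_ge0 => i _; apply: weight_ge0.
Qed.

(** * Transfer from the abstract probability space *)

Section Expectation.
Context (R : realType) (N : nat) (q : R) (T : nat) (D : draws N q T).

Definition history (t : nat) (w : Omega D) : {ffun 'I_t -> draw N} :=
  [ffun i : 'I_t => (preferred i.+1 w, flexible i.+1 w, flex_set i.+1 w)].

Lemma load_run (pi : policy N) t w : load pi t w = run pi (history t w).
Proof.
elim: t => [//|t IH] /=.
have -> : ffun_belast (history t.+1 w) = history t w.
  by apply/ffunP => i; rewrite !ffunE.
by rewrite -IH ffunE.
Qed.

Lemma flexible_prob (i : 'I_T) (b : bool) :
  Pr D (flexible i.+1 @^-1` [set b]) = (if b then q else 1 - q)%:E.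
Proof.
case: b; first exact: flexible_bern.
have [mF _] := draws_indep D.
have := mF (inl (inr i)) _ (ex_intro2 _ _ [set true] I erefl) => mT.
have -> : flexible (d := D) i.+1 @^-1` [set false] =
    ~` (flexible i.+1 @^-1` [set true]).
  by apply/seteqP; split => w /=; case: flexible.
by rewrite probability_setC// flexible_bern.
Qed.

Let event (z : {ffun 'I_T -> draw N}) (k : 'I_T + 'I_T + 'I_T) :
    set (Omega D) :=
  match k with
  | inl (inl i) => preferred i.+1 @^-1` [set (z i).1.1]
  | inl (inr i) => flexible i.+1 @^-1` [set (z i).1.2]
  | inr i => flex_set i.+1 @^-1` [set (z i).2]
  end.

Lemma history_preimageE z : history T @^-1` [set z] =
  \bigcap_(k in [set` [set: 'I_T + 'I_T + 'I_T]%SET]) event z k.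
Proof.
apply/seteqP; split => w /=.
  by move=> /ffunP zE [[i|i]|i] _ /=; rewrite -zE ffunE.
move=> zE; apply/ffunP => i; rewrite ffunE.
have /= -> := zE (inl (inl i)) (finset.in_setT _).
have /= -> := zE (inl (inr i)) (finset.in_setT _).
have /= -> := zE (inr i) (finset.in_setT _).
by case: (z i) => -[].
Qed.

Lemma measurable_history z : measurable (history T @^-1` [set z]).
Proof.
rewrite history_preimageE; apply: fin_bigcap_measurable => [|k _]; first exact: finite_finset.
have [mF _] := draws_indep D; apply: (mF k).
by case: k => [[i|i]|i]; eexists.
Qed.

Lemma history_prob z : Pr D (history T @^-1` [set z]) = (path_weight q z)%:E.
Proof.
have [_ indepD] := draws_indep D.
rewrite history_preimageE indepD => [|[[i|i]|i] _]; try by eexists.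
rewrite (eq_bigl predT) => [|k]; last by rewrite inE.
rewrite big_sumType big_sumType /=.
under eq_bigr do rewrite preferred_unif.
under [X in (_ * X * _)%E]eq_bigr do rewrite flexible_prob.
under [X in (_ * _ * X)%E]eq_bigr do rewrite flex_set_unif.
by rewrite !prodEFin -!EFinM -!big_split.
Qed.

(** [X] is a finite combination of indicators of measurable history events, so it is integrated term
    by term. *)
Lemma expectation_history (X : Omega D -> R) (F : {ffun 'I_T -> draw N} -> R) :
  (forall w, X w = F (history T w)) ->
  ('E_(Pr D)[X])%E = (\sum_z path_weight q z * F z)%:E.
Proof.
move=> XE; rewrite unlock.
under eq_integral => w _.
  rewrite (_ : X w = \sum_z F z * \1_(history T @^-1` [set z]) w); last first.
    rewrite XE (bigD1 (history T w))//= indicE mem_set// mulr1 big1 ?addr0//.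
    move=> z zw; rewrite indicE memNset ?mulr0// => /= zE.
    by rewrite zE eqxx in zw.
  rewrite -sumEFin.
  over.
have intI z : (Pr D).-integrable setT
    (fun w => (\1_(history T @^-1` [set z]) w)%:E).
  by apply: integrable_indic => //; exact: measurable_history.
rewrite integral_sum//= => [|z]; last first.
  exact: (integrableZl measurableT (F z) (intI z)).
rewrite -sumEFin; apply: eq_bigr => z _.
under eq_integral do rewrite EFinM.
rewrite integralZl// integral_indic//; last exact: measurable_history.
by rewrite setIT muleC EFinM; congr (_ * _)%E; exact: history_prob.
Qed.

End Expectation.

(** * The gap and the pair differences *)

Section GapBounds.
Context (R : realType) (N : nat) (x : loads N).
Hypothesis N_gt0 : (0 < N)%N.
Let t := (\sum_i x i)%N.

Let N_gt0R : 0 < N%:R :> R. Proof. by rewrite ltr0n. Qed.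

Lemma max_load_ge_mean : 0 <= (\max_(i < N) x i)%:R - t%:R / N%:R :> R.
Proof.
rewrite subr_ge0 ler_pdivrMr// -natrM ler_nat.
rewrite -[X in (_ <= _ * X)%N](card_ord N) mulnC -sum_nat_const.
by apply: leq_sum => i _; exact: leq_bigmax.
Qed.

(** The gap is the mean over [j] of the differences between a fullest bin [k] and [j]. *)
Lemma max_load_le_diff :
  (\max_(i < N) x i)%:R - t%:R / N%:R <= \sum_i \sum_j `|diff R i j x|.
Proof.
have [|k ->] := bigop.eq_bigmax x; first by rewrite card_ord.
have -> : (x k)%:R - t%:R / N%:R = (\sum_j diff R k j x) / N%:R.
  have -> : \sum_j diff R k j x = (x k)%:R * N%:R - t%:R.
    by rewrite /diff sumrB sumr_const card_ord -natr_sum mulr_natr.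
  by rewrite mulrBl mulfK// gt_eqF.
apply: (@le_trans _ _ (\sum_j `|diff R k j x|)).
  apply: le_trans (ler_norm _) _; rewrite normrM normfV (ger0_norm (ler0n _ _)).
  rewrite ler_pdivrMr//; apply: le_trans (ler_norm_sum _ _ _) _.
  by rewrite ler_peMr ?ler1n// sumr_ge0.
(* [k] depends on [x]; adding the other rows gives a sum over fixed pairs. *)
by rewrite [leRHS](bigD1 k)//= lerDl sumr_ge0// => i _; rewrite sumr_ge0.
Qed.

End GapBounds.

(** * Exponential moments of a pair difference *)

Section Drift.
Context (R : realType) (N : nat) (q : R).
Hypotheses (N2 : (2 <= N)%N) (q01 : 0 < q <= 1).
Implicit Types (x : loads N) (i j : 'I_N) (l : R).

Lemma diffC i j x : diff R i j x = - diff R j i x.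
Proof. by rewrite /diff opprB. Qed.

Lemma diff_eq0 i j x : (diff R i j x == 0) = (x i == x j).
Proof. by rewrite subr_eq0 eqr_nat. Qed.

Lemma avg_expR_random x i j l : `|l| <= 3^-1 ->
  avg q (fun c => expR (l * diff R i j (next false x c))) <=
  expR (l * diff R i j x) * (1 + l ^+ 2).
Proof.
move=> l3; apply: le_trans (avg_expR_diff N2 q01 false x i j l3) _.
by rewrite avg_diff_random// subrr mulr0 addr0.
Qed.

Lemma avg_expR_flexible x i j l : 0 <= l <= 3^-1 -> x i != x j ->
  avg q (fun c => expR (l * `|diff R i j (next true x c)|)) <=
  expR (l * `|diff R i j x|) * (1 - l * (q / 'C(N, 2)%:R) + l ^+ 2).
Proof.
move=> /andP[l_ge0 l3].
wlog xji : i j / (x j < x i)%N.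
  move=> wlg; rewrite neq_ltn => /orP[xij|xji]; last first.
    by apply: wlg; rewrite // gtn_eqF.
  have normC y : `|diff R i j y| = `|diff R j i y| by rewrite diffC normrN.
  rewrite normC; apply: le_trans (wlg j i xij _); last by rewrite gtn_eqF.
  by apply: avg_le => // c; rewrite normC.
move=> _; have d1 : 1 <= diff R i j x.
  by rewrite /diff lerBrDl natr1 ler_nat.
rewrite (ger0_norm (le_trans ler01 d1)).
(* The difference is at least 1 and moves by at most 1, so it stays nonnegative and the absolute
   value can go. *)
apply: (@le_trans _ _ (avg q (fun c => expR (l * diff R i j (next true x c))))).
  apply: avg_le => // c; rewrite ger0_norm//.
  by have := diff_next_bound R true x c i j; rewrite ler_norml; lra.
apply: le_trans (avg_expR_diff N2 q01 true x i j _) _; first by rewrite ger0_norm.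
rewrite ler_wpM2l ?expR_ge0// lerD2r lerD2l -mulrN ler_wpM2l//.
by have := avg_diff_flexible N2 q01 xji; lra.
Qed.

(** Replaces the drift estimate at a tie, where there is no pull towards 0. *)
Lemma expR_norm_next b x c i j l : 0 <= l -> x i = x j ->
  expR (l * `|diff R i j (next b x c)|) <= expR l.
Proof.
move=> l_ge0 xij; rewrite ler_expR ler_piMr//.
have := diff_next_bound R b x c i j.
by have /eqP -> : diff R i j x == 0 by [rewrite diff_eq0 xij]; rewrite subr0.
Qed.

End Drift.

(** * The supersolution for both phases *)

Section Supersolution.
Context (R : realType) (N : nat) (q : R) (i j : 'I_N).
Hypotheses (N2 : (2 <= N)%N) (q01 : 0 < q <= 1).
Implicit Types (x : loads N) (k t : nat) (d : R).

Definition drift : R := q / 'C(N, 2)%:R.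

(** Contraction factor of [avg_expR_flexible] at [l = drift / 3]; it equals
    [1 - 2 / 9 * drift^2]. *)
Definition rate : R := 1 - drift / 3 * drift + (drift / 3) ^+ 2.

(** Fixed point of [m = rate * m + expR (drift / 3)], the recursion that [near_bound] iterates. *)
Definition stationary : R := expR (drift / 3) / (1 - rate).

Lemma drift_gt0 : 0 < drift.
Proof. by case/andP: q01 => q_gt0 _; rewrite divr_gt0// ltr0n bin_gt0. Qed.

Lemma drift_le1 : drift <= 1.
Proof.
case/andP: q01 => _ q_le1; rewrite ler_pdivrMr ?ltr0n ?bin_gt0// mul1r.
by apply: le_trans q_le1 _; rewrite ler1n bin_gt0.
Qed.

Lemma rate_bounds : 0 < rate < 1.
Proof.
have := drift_gt0; have := drift_le1; rewrite /rate => d1 d0.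
by apply/andP; split; nra.
Qed.

Lemma stationary_ge0 : 0 <= stationary.
Proof.
by case/andP: rate_bounds => _ r1; rewrite divr_ge0 ?expR_ge0// subr_ge0 ltW.
Qed.

Let r_ge0 : 0 <= rate. Proof. by case/andP: rate_bounds => /ltW. Qed.

Let rX_le1 k : rate ^+ k <= 1.
Proof. by case/andP: rate_bounds => _ /ltW; exact: exprn_ile1. Qed.

(* Controls the pair difference when it starts near 0, k steps before the end. *)
Definition near_bound k d : R :=
  rate ^+ k * expR (drift / 3 * d) + stationary * (1 - rate ^+ k).

Section Tilt.
Variables (T n : nat) (l : R).
Hypotheses (nT : (n <= T)%N) (l_gt0 : 0 < l) (l3 : l <= 3^-1)
  (Tl : 1 <= T%:R * l).

Definition far_rate : R := l ^+ 2 - l * drift.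

(* Controls it when it starts far from 0: the exponential term bounds the
   contribution of not reaching 0 within k steps. *)
Definition far_bound k d : R :=
  1 + stationary + T%:R * expR (k%:R * far_rate) * expR (l * d).

Definition flexible_bound k x : R :=
  Num.min (near_bound k `|diff R i j x|) (far_bound k `|diff R i j x|).

(** Both signs appear because each exponential obeys the martingale bound [avg_expR_random], whereas
    [|d|] may drift upwards at 0. *)
Definition random_bound t x : R :=
  1 + stationary + T%:R * expR ((T - n)%:R * far_rate) *
    (1 + l ^+ 2) ^+ (n - t) *
    (expR (l * diff R i j x) + expR (- l * diff R i j x)).

(** Here [t] periods have elapsed, and the random phase consists of the first [n]. *)
Definition potential t x : R :=
  if (n <= t)%N then flexible_bound (T - t) x else random_bound t x.

Let l_bounds : 0 <= l <= 3^-1. Proof. by rewrite ltW. Qed.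

Lemma near_bound0_le k : near_bound k 0 <= 1 + stationary.
Proof.
have := stationary_ge0; have := rX_le1 k; have := exprn_ge0 k r_ge0.
by rewrite /near_bound mulr0 expR0; nra.
Qed.

Lemma flexible_bound_step k x :
  avg q (fun c => flexible_bound k (next true x c)) <= flexible_bound k.+1 x.
Proof.
have [xij|xij] := eqVneq (x i) (x j).
  have /eqP d0 : diff R i j x == 0 by rewrite diff_eq0 xij.
  rewrite /flexible_bound d0 normr0 [leRHS]min_l; last first.
    apply: le_trans (near_bound0_le _) _; rewrite /far_bound lerDl.
    by rewrite !mulr_ge0 ?expR_ge0.
  apply: (@le_trans _ _ (avg q (fun _ : draw N => near_bound k 1))).
    apply: avg_le => // c; rewrite ge_min; apply/orP; left.
    rewrite /near_bound lerD2r ler_wpM2l ?exprn_ge0// mulr1.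
    by apply: expR_norm_next => //; have := drift_gt0; lra.
  rewrite avg_cst// /near_bound mulr0 mulr1 expR0 exprS.
  (* By the choice of [stationary], the two sides now differ exactly by [rate^(k+1)], which is
     nonnegative. *)
  have -> : expR (drift / 3) = stationary * (1 - rate).
    by rewrite divfK// subr_eq0 gt_eqF//; case/andP: rate_bounds.
  by have := mulr_ge0 r_ge0 (exprn_ge0 k r_ge0); lra.
rewrite /flexible_bound le_min; apply/andP; split.
- apply: (@le_trans _ _ (avg q (fun c => rate ^+ k *
      expR (drift / 3 * `|diff R i j (next true x c)|) +
      stationary * (1 - rate ^+ k)))).
    by apply: avg_le => // c; rewrite ge_min lexx.
  rewrite avgD avgZ avg_cst// lerD//.
    rewrite exprSr -mulrA ler_wpM2l ?exprn_ge0//.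
    have d3 : 0 <= drift / 3 <= 3^-1.
      by have := drift_gt0; have := drift_le1 => d1 d0; apply/andP; split; lra.
    by apply: le_trans (avg_expR_flexible N2 q01 d3 xij) _; rewrite mulrC.
  rewrite ler_wpM2l ?stationary_ge0// lerD2l lerN2 exprS.
  by apply: ler_piMl; rewrite ?exprn_ge0//; case/andP: rate_bounds => _ /ltW.
- apply: (@le_trans _ _ (avg q (fun c => 1 + stationary +
      T%:R * expR (k%:R * far_rate) *
      expR (l * `|diff R i j (next true x c)|)))).
    by apply: avg_le => // c; rewrite ge_min lexx orbT.
  rewrite avgD avgZ avg_cst// lerD2l -natr1 mulrDl mul1r expRD -!mulrA.
  rewrite !ler_wpM2l ?expR_ge0//.
  apply: le_trans (avg_expR_flexible N2 q01 l_bounds xij) _.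
  rewrite mulrC ler_wpM2r ?expR_ge0//.
  by have := expR_ge1Dx far_rate; rewrite /far_rate -/drift; lra.
Qed.

Lemma flexible_le_random x : flexible_bound (T - n) x <= random_bound n x.
Proof.
rewrite /flexible_bound ge_min; apply/orP; right.
rewrite /far_bound /random_bound subnn expr0 mulr1 lerD2l.
rewrite ler_wpM2l ?mulr_ge0 ?expR_ge0//.
have [d0|/ltW d0] := leP 0 (diff R i j x).
  by rewrite ger0_norm// lerDl expR_ge0.
by rewrite ler0_norm// mulNr mulrN lerDr expR_ge0.
Qed.

Lemma random_bound_step t x : (t < n)%N ->
  avg q (fun c => random_bound t.+1 (next false x c)) <= random_bound t x.
Proof.
move=> tn; rewrite /random_bound avgD avg_cst// avgZ avgD lerD2l.
rewrite (_ : n - t = (n - t.+1).+1)%N; last by lia.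
rewrite [in leRHS]exprSr mulrA -[leRHS]mulrA.
rewrite ler_wpM2l ?mulr_ge0 ?expR_ge0 ?exprn_ge0 ?addr_ge0 ?sqr_ge0//.
rewrite mulrDr lerD// mulrC.
  by apply: avg_expR_random => //; rewrite gtr0_norm.
by rewrite -[l in (1 + l ^+ 2)]opprK sqrrN; apply: avg_expR_random;
  rewrite // normrN gtr0_norm.
Qed.

Lemma potential_step t x : (t < T)%N ->
  avg q (fun c => potential t.+1 (next (n <= t)%N x c)) <= potential t x.
Proof.
move=> tT; rewrite /potential; case: (leqP n t) => [nt|tn].
  rewrite (leqW nt) (_ : T - t = (T - t.+1).+1)%N; last by lia.
  exact: flexible_bound_step.
apply: le_trans (random_bound_step _ tn); apply: avg_le => // c.
(* After the last random period the potential has already changed form. *)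
case: leqP => // nt1; have -> : t.+1 = n by lia.
exact: flexible_le_random.
Qed.

(** This is what the prefactor [T] of [far_bound] is for: as [1 <= T * l], the term
    [T * expR (l * |d|)] dominates [|d|]. *)
Lemma potential_end x : drift / 3 * `|diff R i j x| <= potential T x.
Proof.
have := drift_gt0; have := drift_le1 => d1 d0; have := stationary_ge0 => s0.
rewrite /potential nT subnn /flexible_bound le_min; apply/andP; split.
  rewrite /near_bound expr0 mul1r subrr mulr0 addr0.
  by have := expR_ge1Dx (drift / 3 * `|diff R i j x|); lra.
rewrite /far_bound mul0r expR0 mulr1.
have := expR_ge1Dx (l * `|diff R i j x|); have := normr_ge0 (diff R i j x).
set e := expR _; set d := `|_| => dge0 h.
have T0 : 0 <= T%:R :> R by [].
have h1 : T%:R * (l * d) <= T%:R * e by apply: ler_wpM2l => //; lra.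
have h2 : 1 * d <= T%:R * l * d by apply: ler_wpM2r.
have h3 : drift / 3 * d <= 1 * d by apply: ler_wpM2r => //; lra.
by lra.
Qed.

Lemma expected_diff_bound (pi : policy N) :
  (forall t x, pi t.+1 x = (n <= t)%N) ->
  n = 0%N \/ T%:R * expR ((T - n)%:R * far_rate + n%:R * l ^+ 2) <= 1 ->
  \sum_(z : {ffun 'I_T -> draw N}) path_weight q z * `|diff R i j (run pi z)|
    <= (3 + stationary) / (drift / 3).
Proof.
move=> piE start; have d0 := drift_gt0.
rewrite ler_pdivlMr; last by lra.
have super t x : (t < T)%N ->
    avg q (fun c => potential t.+1 (next (pi t.+1 x) x c)) <= potential t x.
  by move=> tT; rewrite piE; exact: potential_step.
apply: (@le_trans _ _ (\sum_(z : {ffun 'I_T -> draw N})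
    path_weight q z * potential T (run pi z))).
  rewrite mulr_suml; apply: ler_sum => z _; rewrite -mulrA ler_wpM2l//.
    by apply: prodr_ge0 => *; exact: weight_ge0.
  by rewrite mulrC; exact: potential_end.
apply: le_trans (supersolution_bound N2 q01 super) _.
have z0 : diff R i j [ffun=> 0%N] = 0 by rewrite /diff !ffunE subrr.
rewrite /potential; case: leqP => [_|n0].
  rewrite /flexible_bound z0 normr0 ge_min; apply/orP; left.
  by apply: le_trans (near_bound0_le _) _; lra.
case: start => [n_eq0|start]; first by rewrite n_eq0 in n0.
(* At zero loads both exponentials equal 1, so the last term adds at most 2, whence the constant
   3. *)
rewrite /random_bound z0 !mulr0 expR0 subn0.
have : T%:R * expR ((T - n)%:R * far_rate) * (1 + l ^+ 2) ^+ n <= 1.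
  apply: le_trans start; rewrite expRD mulrA ler_wpM2l ?mulr_ge0 ?expR_ge0//.
  rewrite expRM_natl lerXn2r ?nnegrE ?expR_ge0//; last exact: expR_ge1Dx.
  by rewrite addr_ge0 ?sqr_ge0.
by lra.
Qed.

End Tilt.
End Supersolution.

(** * Switching time and choice of the tilt *)

Lemma static_policy_switch (R : realType) (N : nat) (a : R) (T : nat) : 0 <= a ->
  exists n : nat, [/\ (n <= T)%N,
    forall t (x : loads N), static_policy a T t.+1 x = (n <= t)%N &
    n = 0%N \/ a * Num.sqrt (T%:R * ln T%:R) <= (T - n)%:R].
Proof.
move=> a0; rewrite /static_policy; set s := switch_time a T.
(* If the switch comes by period 1, all periods are flexible, but [T] may be below the length
   required in the second alternative. *)
have [s1|s1] := leP s 1.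
  exists 0%N; split=> //; last by left.
  by move=> t _; lia.
(* Period [t.+1] follows [t] elapsed periods, so [n] is the switching time minus one. *)
have [n sE] : exists n : nat, s = n.+1%:Z by exists `|s - 1|%N; lia.
have b0 : 0 <= a * Num.sqrt (T%:R * ln T%:R) by rewrite mulr_ge0 ?sqrtr_ge0.
have : (s%:~R : R) <= T%:R - a * Num.sqrt (T%:R * ln T%:R) by exact: floor_le.
rewrite sE -pmulrn -natr1 => sle.
have nT : (n <= T)%N by rewrite -(ler_nat R); lra.
exists n; split; [by []|by move=> t _; lia|].
by right; rewrite natrB//; lra.
Qed.

(* With l^2 = ln T / T, the terms in l^2 sum to ln T and the drift contributes at
   most - 2 ln T to the exponent. *)
Lemma tilt_exists (R : realType) (T : nat) : (324 <= T)%N ->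
  exists l : R, [/\ 0 < l, l <= 3^-1, 1 <= T%:R * l &
    forall (a d : R) (n : nat), (n <= T)%N -> 0 < d -> 2 <= a * d ->
      a * Num.sqrt (T%:R * ln T%:R) <= (T - n)%:R ->
      T%:R * expR ((T - n)%:R * (l ^+ 2 - l * d) + n%:R * l ^+ 2) <= 1].
Proof.
move=> T324; have T0 : 0 < T%:R :> R by rewrite ltr0n; lia.
set s := Num.sqrt (T%:R : R); have sE : T%:R = s ^+ 2 by rewrite sqr_sqrtr ?ltW.
(* As [ln s <= s - 1], [l^2 = 2 ln s / s^2] is below [2 / s], hence below [1/9] once [s >= 18]; and
   [18^2 = 324]. *)
have s18 : 18 <= s.
  have -> : (18 : R) = Num.sqrt (18 ^+ 2) by rewrite sqrtr_sqr ger0_norm.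
  by rewrite ler_sqrt// -natrX ler_nat.
have s0 : 0 < s by lra.
have lnT : ln T%:R = ln s *+ 2 by rewrite sE lnXn.
have lns_le : ln s <= s - 1.
  by have := @le_ln1Dx R (s - 1); rewrite [1 + _]addrC subrK; apply; lra.
have lns_ge : 1 - s^-1 <= ln s.
  have := @le_ln1Dx R (s^-1 - 1); rewrite [1 + _]addrC subrK lnV ?posrE//.
  by have := s0; rewrite -invr_gt0 => si; move=> /(_ ltac:(lra)); lra.
have s18i : s^-1 <= 18^-1 by rewrite lef_pV2 ?posrE.
have lnT1 : 1 <= ln T%:R :> R by rewrite lnT mulr2n; lra.
set u := Num.sqrt (ln (T%:R : R)).
have uE : ln T%:R = u ^+ 2 by rewrite sqr_sqrtr//; lra.
have u1 : 1 <= u by rewrite -sqrtr1 ler_wsqrtr.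
have lE : u = u / s * s by rewrite divfK// gt_eqF.
exists (u / s); set l := u / s in lE *; split.
- by rewrite divr_gt0//; lra.
- rewrite -ler_sqr ?nnegrE ?divr_ge0//; [|lra..].
  rewrite expr_div_n -uE ler_pdivrMr ?exprn_gt0// lnT mulr2n.
  by rewrite exprVn; nra.
- by rewrite sE expr2 -mulrA [s * l]mulrC -lE; nra.
- move=> a d n nT d0 ad; rewrite (sqrtrM _ (ltW T0)) -/s -/u => an.
  have l0 : 0 < l by rewrite divr_gt0//; lra.
  have h1 : l * d * (a * (s * u)) <= l * d * (T - n)%:R.
    by rewrite ler_wpM2l// mulr_ge0 ?ltW.
  have h2 : 2 * u ^+ 2 <= l * d * (a * (s * u)).
    rewrite [leRHS](_ : _ = a * d * (l * s * u)); last by ring.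
    by rewrite -lE -expr2 ler_wpM2r ?sqr_ge0.
  have h3 : (T - n)%:R * (l ^+ 2 - l * d) + n%:R * l ^+ 2 =
      u ^+ 2 - l * d * (T - n)%:R.
    have -> : u ^+ 2 = l ^+ 2 * T%:R by rewrite {1}lE exprMn sE.
    by rewrite natrB//; ring.
  (* Since [2 <= a * d], the exponent is at most [- ln T], which exactly cancels the prefactor
     [T]. *)
  apply: (@le_trans _ _ (T%:R * expR (- ln T%:R))).
    by rewrite ler_wpM2l// ler_expR h3 uE; lra.
  by rewrite expRN lnK ?posrE// divff// gt_eqF.
Qed.

Unset Implicit Arguments.

Theorem theorem1 (R : realType) (N : nat) (q : R) (a : R)
    (D : forall T : nat, draws N q T) :
  (2 <= N)%N -> 0 < q <= 1 ->
  0 < a -> 2 * Num.sqrt 2 * 'C(N, 2)%:R / q <= a ->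
  (fun T : nat => expected_gap (D T) (static_policy a T) T)
    =O_\oo (fun _ : nat => 1 : R).
Proof.
move=> N2 q01 a0 a_large.
have d0 := drift_gt0 N2 q01.
(* [a_large] amounts to [2 sqrt 2 <= a * drift]. *)
have ad : 2 <= a * drift N q.
  have q0 : 0 < q by case/andP: q01.
  have C0 : 0 < 'C(N, 2)%:R :> R by rewrite ltr0n bin_gt0.
  have sqrt2 : 1 <= Num.sqrt 2 :> R by rewrite -[leLHS]sqrtr1 ler_wsqrtr// ler1n.
  move: a_large; rewrite ler_pdivrMr// => a_large.
  by rewrite /drift mulrA ler_pdivlMr//; nra.
pose M : R := \sum_(i < N) \sum_(j < N) (3 + stationary N q) / (drift N q / 3).
(* [M] is independent of [T]; adding 1 makes the constant strictly positive. *)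
apply/eqO_exP; exists (1 + M).
  rewrite ltr_pwDl// sumr_ge0// => i _; rewrite sumr_ge0// => j _.
  by rewrite divr_ge0//; have := stationary_ge0 N2 q01; lra.
exists 324%N => // T /= T324; rewrite normr1 mulr1.
have [n [nT piE start]] := static_policy_switch N T (ltW a0).
have [l [l0 l3 Tl tilt]] := @tilt_exists R T T324.
rewrite /expected_gap (expectation_history (F := fun z =>
  (\max_(i < N) run (static_policy a T) z i)%:R - T%:R / N%:R)); last first.
  by move=> w; rewrite /gap load_run.
have N0 : (0 < N)%N by lia.
have gap_ge0 (z : {ffun 'I_T -> draw N}) :
    0 <= (\max_(i < N) run (static_policy a T) z i)%:R - T%:R / N%:R :> R.
  by have := max_load_ge_mean R (run (static_policy a T) z) N0; rewrite sum_run.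
have w_ge0 (z : {ffun 'I_T -> draw N}) : 0 <= path_weight q z.
  by apply: prodr_ge0 => *; exact: weight_ge0.
rewrite /= ger0_norm; last first.
  by rewrite sumr_ge0// => z _; rewrite mulr_ge0.
apply: (@le_trans _ _ M); last by rewrite lerDr.
apply: (@le_trans _ _ (\sum_(z : {ffun 'I_T -> draw N}) path_weight q z *
   \sum_i \sum_j `|diff R i j (run (static_policy a T) z)|)).
  apply: ler_sum => z _; rewrite ler_wpM2l//.
  have := max_load_le_diff R (run (static_policy a T) z) N0.
  by rewrite sum_run.
under eq_bigr do rewrite mulr_sumr.
rewrite exchange_big/=; apply: ler_sum => i _.
under eq_bigr do rewrite mulr_sumr.
rewrite exchange_big/=; apply: ler_sum => j _.
apply: (@expected_diff_bound R N q i j N2 q01 T n l nT l0 l3 Tl _ piE).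
case: start => [->|start]; [by left | right].
exact: tilt start.
Qed.
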